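(* Let $l<k$ be positive integers, let $A,B_1,\dots,B_k$ be finite sets in a commutative group $G$ with $A$ nonempty, and let $0<\varepsilon<1$. Let $K=\{1,\dots,k\}$, for $I\subseteq K$ put $B_I=\sum_{i\in I}B_i$, $|A|=m$, $|A+B_I|=\alpha_I m$. For $J\subseteq K$ with $j=|J|$, $l\le j\le k$, define $$\beta_J=\Bigl(\prod_{L\subseteq J,\ |L|=l}\alpha_L\Bigr)^{(l-1)!\,(j-l)!/(j-1)!}.$$ Then there is a constant $c$ depending only on $k,l,\varepsilon$ such that there exists $X\subseteq A$ with $|X|>(1-\varepsilon)m$ and $|X+B_J|\le c\,\beta_J\,|X|$ for every $J\subseteq K$ with $|J|\ge l$.
   Context: Sumsets are $X+Y=\{x+y:x\in X,y\in Y\}$. *)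

(* Defs.v *)
From HB Require Import structures.
From mathcomp Require Import all_boot all_order all_algebra finmap.
From mathcomp Require Import reals exp.
Set Implicit Arguments. Unset Strict Implicit. Unset Printing Implicit Defensive.
Import Order.TTheory GRing.Theory Num.Theory.
Local Open Scope ring_scope.
Local Open Scope fset_scope.

Definition sumset (G : zmodType) (X Y : {fset G}) : {fset G} :=
  [fset (x + y)%R | x : G in X, y : G in Y].

Definition Bsum (G : zmodType) (k : nat) (B : 'I_k -> {fset G}) (I : {set 'I_k})
  : {fset G} := \big[@sumset G/[fset (0 : G)%R]]_(i in I) B i.

Definition alpha (R : realType) (G : zmodType) (k : nat) (A : {fset G})
  (B : 'I_k -> {fset G}) (I : {set 'I_k}) : R :=
  (#|` sumset A (Bsum B I)|%:R / #|` A|%:R).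

Definition beta (R : realType) (G : zmodType) (k l : nat) (A : {fset G})
  (B : 'I_k -> {fset G}) (J : {set 'I_k}) : R :=
  powR (\prod_(L : {set 'I_k} | (L \subset J) && (#|L| == l)) alpha R A B L)
       (((l.-1)`! * (#|J| - l)`!)%:R / ((#|J|).-1)`!%:R).

(* Main.v *)
(* Place the sums A + B_I, for I a subset of J, on the vertices (x, I) of a
   layered graph, adding an element of B_i being a step from I to I :|: {i}, and
   weigh (x, I) by the product of t_i over i in I. Two consecutive steps can be
   exchanged, and this lets a minimum-weight cut be pushed down, one layer at a
   time, to the first and last layers. If |Z| <= w_J |Z + B_J| for all Z in A,
   then A is a lightest cut, so |A| <= \sum_(|L| = l) w_L |A + B_L|, the weight of
   the l-th layer. For |J| = l + 1 the t_i can be chosen to balance this sum,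
   which yields a nonempty X with |X + B_J| <= c beta_J |X|; greedily collecting
   such sets makes X fill most of A. The exponents defining beta compose when l
   grows one step at a time, so induction on |J| gives the general case, the loss
   in each step being absorbed into the constant. *)
Require Import Defs.
From HB Require Import structures.
From mathcomp Require Import all_boot all_order all_algebra finmap.
From mathcomp Require Import reals exp.
From mathcomp Require Import ring lra zify.
Set Implicit Arguments. Unset Strict Implicit. Unset Printing Implicit Defensive.
Import Order.TTheory GRing.Theory Num.Theory.
Local Open Scope ring_scope.

(** * Minimum cuts in weighted commutative graphs *)

(** Lower [p] on its positive support [U] by its least value there, and [q] by the same amount on
    the neighbours of [U]. The Hall condition for [U] pays for the slice removed, and the support
    shrinks. *)
Lemma weighted_hall_sum (R : realDomainType) (T : finType) (r : rel T)
    (w p q : T -> R) (S X : {set T}) :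
  (forall v, 0 <= w v) ->
  (forall U : {set T}, U \subset S ->
     \sum_(s in U) w s <= \sum_(x in X | [exists s in U, r s x]) w x) ->
  (forall x, x \in X -> 0 <= q x) ->
  (forall s x, s \in S -> x \in X -> r s x -> p s <= q x) ->
  \sum_(s in S) w s * p s <= \sum_(x in X) w x * q x.
Proof.
move=> w0 hall.
have [n] := ubnP #|[set s in S | 0 < p s]|; elim: n p q => // n IHn p q ltn q0 pq.
set U := [set s in S | 0 < p s] in ltn.
have US : U \subset S by apply/subsetP => s; rewrite inE => /andP[].
case: (set_0Vmem U) => [U0 | [s1 Us1]].
  apply: (@le_trans _ _ 0).
    apply: sumr_le0 => s Ss; apply: mulr_ge0_le0 => //; rewrite leNgt.
    by apply/negP => ps; have := in_set0 s; rewrite -U0 inE Ss ps.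
  by apply: sumr_ge0 => x Xx; rewrite mulr_ge0 ?q0.
case: (@arg_minP _ _ _ s1 (mem U) p Us1) => s0 /= Us0 mins0; have {}Us0 : s0 \in U := Us0.
have ps0 : 0 < p s0 by move: Us0; rewrite inE => /andP[].
pose N := fun x => [exists s in U, r s x].
have split_sum (f : T -> R) (Y : {set T}) (Q : pred T) :
    \sum_(v in Y) w v * f v =
    \sum_(v in Y) w v * (f v - p s0 * (Q v)%:R) + p s0 * \sum_(v in Y | Q v) w v.
  rewrite big_mkcondr /= mulr_sumr -big_split; apply: eq_bigr => v _ /=.
  by case: (Q v) => /=; ring.
rewrite (split_sum p S (mem U)) (split_sum q X N).
have -> : \sum_(v in S | v \in U) w v = \sum_(v in U) w v.
  by apply: eq_bigl => v; rewrite inE andbA andbb.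
apply: lerD; last by rewrite ler_pM2l // hall.
have q'0 x : x \in X -> 0 <= q x - p s0 * (N x)%:R.
  move=> Xx; case: (boolP (N x)) => [/exists_inP[s Us rsx]|_].
    rewrite mulr1 subr_ge0 (le_trans (mins0 _ Us)) // pq //.
    exact: (subsetP US).
  by rewrite mulr0 subr0 q0.
apply: (IHn (fun s => p s - p s0 * (s \in U)%:R) (fun x => q x - p s0 * (N x)%:R))
  => [|//|s x Ss Xx rsx].
  rewrite -ltnS; apply: leq_trans ltn; rewrite ltnS; apply: proper_card; apply/properP; split.
    apply/subsetP => s; rewrite !inE => /andP[Ss]; rewrite Ss /=.
    by case: (boolP (0 < p s)) => //= ps; rewrite mulr0 subr0 (negPf ps).
  by exists s0; rewrite // inE Us0 /= mulr1 subrr ltxx andbF.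
case: (boolP (s \in U)) => Us.
  have -> : N x by apply/exists_inP; exists s.
  by rewrite lerD2r pq.
rewrite mulr0 subr0 (le_trans _ (q'0 x Xx)) // leNgt.
by apply: contraNN Us => ps; rewrite inE Ss.
Qed.

(** Lower both [p] and [q] by the minimum [q x0] of [q] on [X] and apply the previous inequality. As
    the original sums compare the other way, what remains is [q x0] times the claim. *)
Lemma weighted_hall_saturated (R : realDomainType) (T : finType) (r : rel T)
    (w p q : T -> R) (S X : {set T}) :
  (forall v, 0 <= w v) ->
  (forall U : {set T}, U \subset S ->
     \sum_(s in U) w s <= \sum_(x in X | [exists s in U, r s x]) w x) ->
  (forall x, x \in X -> 0 < q x) ->
  (forall s x, s \in S -> x \in X -> r s x -> p s <= q x) ->
  \sum_(x in X) w x * q x <= \sum_(s in S) w s * p s ->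
  \sum_(x in X) w x <= \sum_(s in S) w s.
Proof.
move=> w0 hall q0 pq le_qp.
case: (set_0Vmem X) => [-> | [x1 Xx1]]; first by rewrite big_set0 sumr_ge0.
case: (@arg_minP _ _ _ x1 (mem X) q Xx1) => x0 /= Xx0 minx0; have {}Xx0 : x0 \in X := Xx0.
have sum_sub (f : T -> R) (Y : {set T}) :
    \sum_(v in Y) w v * (f v - q x0) =
    \sum_(v in Y) w v * f v - q x0 * \sum_(v in Y) w v.
  by rewrite mulr_sumr -sumrB; apply: eq_bigr => v _; ring.
have : \sum_(s in S) w s * (p s - q x0) <= \sum_(x in X) w x * (q x - q x0).
  apply: (weighted_hall_sum (r := r)) => // [x Xx|s x Ss Xx rsx].
    by rewrite subr_ge0 minx0.
  by rewrite lerD2r pq.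
rewrite !sum_sub => le_pq; rewrite -(ler_pM2l (q0 _ Xx0)); lra.
Qed.

Lemma sum_inj_le (R : numDomainType) (T T' : finType) (P : pred T) (Q : pred T')
    (f : T' -> R) (h : T -> T') :
  (forall v, 0 <= f v) -> (forall y, P y -> Q (h y)) ->
  (forall y y', P y -> P y' -> h y = h y' -> y = y') ->
  \sum_(y | P y) f (h y) <= \sum_(v | Q v) f v.
Proof.
move=> f0 PQ injh.
have -> : \sum_(y | P y) f (h y) = \sum_(v in [set h y | y in P]) f v.
  by rewrite big_imset //= => y y' Py Py'; apply: injh.
rewrite [leRHS](bigID (mem [set h y | y in P])) /= -[leLHS]addr0 lerD ?sumr_ge0 //.
rewrite le_eqVlt; apply/orP; left; apply/eqP/eq_bigl => v.
by case: imsetP => [[y Py ->]|]; rewrite ?andbF ?PQ.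
Qed.

Lemma exchange_sum_rel (R : numDomainType) (T T' : finType) (r : T -> T' -> bool)
    (S : {set T}) (Y : {set T'}) (f : T -> T' -> R) :
  \sum_(s in S) \sum_(y in Y | r s y) f s y =
  \sum_(y in Y) \sum_(s in S | r s y) f s y.
Proof.
rewrite (exchange_big_dep (mem Y)) => [|s y _ /andP[]//]; apply: eq_bigr => y /= Yy.
by apply: eq_bigl => s; rewrite [y \in Y]Yy.
Qed.

Section MinimumCut.
Variables (R : realFieldType) (T : finType) (e : rel T) (lev : T -> nat).
Variables (w : T -> R) (c : T -> T -> T -> T) (k : nat).
Hypothesis w_gt0 : forall v, 0 < w v.
Hypothesis levS : forall x y, e x y -> lev y = (lev x).+1.
(** [c x s y] is the middle vertex of the path from [x] to [y] that takes the two steps in the other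
    order. *)
Hypothesis commute : forall x s y, e x s -> e s y ->
  [/\ e x (c x s y), e (c x s y) y & w (c x s y) * w s = w x * w y].
Hypothesis commute_injr : forall x s y y', e x s -> e s y -> e s y' ->
  c x s y = c x s y' -> y = y'.
Hypothesis commute_injl : forall x x' s y, e x s -> e x' s -> e s y ->
  c x s y = c x' s y -> x = x'.

(* [boundary P] meets every path from level 0 to level [k] whenever [P] avoids
   level [k]: it is the set of vertices at which a path can leave [P]. *)
Definition boundary (P : {set T}) : {set T} :=
  [set v | (v \notin P) && ((lev v == 0) || [exists x in P, e x v])].
Definition weight (S : {set T}) : R := \sum_(v in S) w v.
Definition is_cut (P : {set T}) := [forall v in P, lev v != k].
Definition min_cut (P : {set T}) :=
  is_cut P /\ forall Q, is_cut Q -> weight (boundary P) <= weight (boundary Q).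

Lemma weight_le (S S' : {set T}) : S \subset S' -> weight S <= weight S'.
Proof.
move=> SS'; rewrite /weight [leRHS](big_setID S) /= (setIidPr SS') lerDl.
by rewrite sumr_ge0 // => v _; rewrite ltW.
Qed.

Lemma weightU (S S' : {set T}) : weight (S :|: S') <= weight S + weight S'.
Proof.
rewrite /weight (big_setID S) /= lerD ?weight_le //.
  by rewrite subsetIr.
by apply/subsetP => v; rewrite !inE => /andP[/negPf->].
Qed.

Lemma weightD (S S' : {set T}) : S' \subset S ->
  weight (S :\: S') = weight S - weight S'.
Proof.
move=> S'S; rewrite /weight [in RHS](big_setID S') /= (setIidPr S'S).
by rewrite addrAC subrr add0r.
Qed.

(** Trading [U] for [X] in the boundary cannot make a minimum cut lighter. With the next two lemmas
    this supplies Hall conditions below and above a layer. *)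
Lemma min_cutU (P U S : {set T}) (X : {set T}) : min_cut P -> U \subset boundary P ->
  is_cut S -> boundary S \subset (boundary P :\: U) :|: X -> weight U <= weight X.
Proof.
move=> [_ minP] UP cS bS.
have := le_trans (minP _ cS) (le_trans (weight_le bS) (weightU _ _)).
by rewrite weightD //; lra.
Qed.

(** A vertex of [U] whose predecessors have left [P] could stay in the boundary only by having level
    0; the removed vertices are the only possible newcomers. *)
Lemma boundary_down (P U : {set T}) : U \subset boundary P ->
  (forall s, s \in U -> lev s != 0) ->
  boundary (P :\: [set x in P | [exists s in U, e x s]]) \subset
  (boundary P :\: U) :|: [set x in P | [exists s in U, e x s]].
Proof.
move=> UP lev0; apply/subsetP => v; rewrite !inE.
have [vP|vP] := boolP (v \in P) => /=; first by rewrite andbT negbK => /andP[-> _]; rewrite orbT.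
rewrite ?andbF ?orbF => h; apply/andP; split.
  apply/negP => vU; move: h; rewrite (negPf (lev0 _ vU)) /=.
  case/exists_inP => x; rewrite !inE => /andP[nx xP] exv; move: nx; rewrite xP /=.
  by case/exists_inP; exists v.
case/orP: h => [->//|/exists_inP[x]]; rewrite !inE => /andP[_ xP] exv.
by apply/orP; right; apply/exists_inP; exists x.
Qed.

Lemma boundary_up (P U : {set T}) : U \subset boundary P ->
  boundary (P :|: U) \subset (boundary P :\: U) :|:
    [set y in ~: (P :|: boundary P) | [exists s in U, e s y]].
Proof.
move=> UP; apply/subsetP => v; rewrite !inE negb_or -andbA => /and3P[vP vU h].
rewrite vU vP /=.
case: (boolP (lev v == 0)) h => //= l0 /exists_inP[x]; rewrite !inE.
case/orP=> [xP|xU] exv.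
  by have -> : [exists x in P, e x v] by apply/exists_inP; exists x.
case: [exists x in P, e x v] => //=; rewrite orbF vP.
by apply/exists_inP; exists x.
Qed.

(* Let [X] be the set of vertices of [P] with an edge into [S], and [Y] the set
   of vertices outside [P :|: boundary P] with an edge from [S]. If x -> s -> y,
   exchanging the two steps passes through another vertex of [S]. Combined with
   the Hall conditions given by minimality, this makes the weighted numbers of
   edges X -> S and S -> Y agree, which forces [X] to be no heavier than [S]. *)
Lemma min_cut_pred_le (P : {set T}) (j : nat) : (0 < j < k)%N -> min_cut P ->
  weight [set x in P | [exists s in [set s in boundary P | lev s == j], e x s]] <=
  weight [set s in boundary P | lev s == j].
Proof.
move=> /andP[j0 jk] mP; set S := [set s in boundary P | _]; case: (mP) => cP _.
set X := [set x in P | _].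
pose Y := [set y in ~: (P :|: boundary P) | [exists s in S, e s y]].
have SB : S \subset boundary P by apply/subsetP => s; rewrite inE => /andP[].
have Slev s : s \in S -> lev s = j by rewrite inE => /andP[_ /eqP].
have hall_down (U : {set T}) : U \subset S ->
    \sum_(s in U) w s <= \sum_(x in X | [exists s in U, e x s]) w x.
  move=> US; have UB := subset_trans US SB.
  have lev0 s : s \in U -> lev s != 0.
    by move=> /(subsetP US)/Slev ->; rewrite -lt0n.
  have := min_cutU mP UB _ (boundary_down UB lev0).
  move=> /(_ _)/le_trans; apply.
    apply/forall_inP => v; rewrite !inE => /andP[_ vP].
    exact: (forall_inP cP).
  rewrite /weight le_eqVlt; apply/orP; left; apply/eqP/eq_bigl => x; rewrite !inE.
  case: (x \in P) => //=; case: (boolP [exists s in U, e x s]); rewrite ?andbF //.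
  case/exists_inP => s Us exs; rewrite andbT; symmetry; apply/exists_inP.
  by exists s => //; apply: (subsetP US).
have hall_up (U : {set T}) : U \subset S ->
    \sum_(s in U) w s <= \sum_(y in Y | [exists s in U, e s y]) w y.
  move=> US; have UB := subset_trans US SB.
  have := min_cutU mP UB _ (boundary_up UB).
  move=> /(_ _)/le_trans; apply.
    apply/forall_inP => v; rewrite !inE => /orP[|/(subsetP US)/Slev ->].
      exact: (forall_inP cP).
    by rewrite ltn_eqF.
  rewrite /weight le_eqVlt; apply/orP; left; apply/eqP/eq_bigl => x; rewrite !inE.
  case: (x \in P) => //=; case: (boolP [exists s in U, e s x]); rewrite ?andbF //.
  case/exists_inP => s Us exs; rewrite !andbT.
  suff -> : [exists s in S, e s x] by rewrite andbT.
  by apply/exists_inP; exists s => //; apply: (subsetP US).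
(* If the exchanged vertex lay in [P], its successor [y] would be in [P] or in [boundary P]. So it
   is outside [P] and reached from [x]. *)
have mid x s y : x \in X -> s \in S -> y \in Y -> e x s -> e s y -> c x s y \in S.
  rewrite !inE => /andP[xP _] /andP[_ /eqP ls] /andP[yN _] exs esy.
  have [exv evy _] := commute exs esy.
  move: yN; rewrite negb_or => /andP[yP yB].
  have lv : lev (c x s y) = j.
    by have := levS exv; rewrite -ls (levS exs).
  have vP : c x s y \notin P.
    apply: contraNN yB => vP; rewrite yP /=; apply/orP; right.
    by apply/exists_inP; exists (c x s y).
  rewrite vP lv eqxx andbT /=; apply/orP; right; apply/exists_inP.
  by exists x.
pose outY s := \sum_(y in Y | e s y) (1 : R).
pose outS x := \sum_(s in S | e x s) (1 : R).
(* [E] and [F] count the edges from [S] to [Y] and from [X] to [S], each weighted by its tail. *)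
pose E := \sum_(s in S) \sum_(y in Y | e s y) w s.
pose F := \sum_(s in S) \sum_(x in X | e x s) w x.
have wge0 v : 0 <= w v by apply: ltW.
have EE : \sum_(s in S) w s * outY s = E.
  by apply: eq_bigr => s _; rewrite mulr_sumr; apply: eq_bigr => y _; rewrite mulr1.
have FF : \sum_(x in X) w x * outS x = F.
  rewrite /F exchange_sum_rel; apply: eq_bigr => x _; rewrite mulr_sumr.
  by apply: eq_bigr => s _; rewrite mulr1.
have out_le s x : s \in S -> x \in X -> e x s -> outY s <= outS x.
  move=> Ss Xx exs; apply: (sum_inj_le (h := c x s)) => // [y|y y'] /andP[Yy esy].
    by have [exv _ _] := commute exs esy; rewrite exv (mid _ _ _ Xx Ss).
  by move=> /andP[_ esy']; apply: commute_injr.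
(* By [commute], [w x / w s = w (c x s y) / w y], so exchanging steps injects the terms of [inX s]
   into those of [inS y]; [hall_up] then compares the sums. *)
have FE : F <= E.
  pose inX s := \sum_(x in X | e x s) (w x / w s).
  pose inS y := \sum_(s in S | e s y) (w s / w y).
  have -> : F = \sum_(s in S) w s * inX s.
    apply: eq_bigr => s _; rewrite mulr_sumr; apply: eq_bigr => x _.
    by rewrite mulrC divfK // gt_eqF.
  have -> : E = \sum_(y in Y) w y * inS y.
    rewrite /E exchange_sum_rel; apply: eq_bigr => y _; rewrite mulr_sumr.
    by apply: eq_bigr => s _; rewrite mulrC divfK // gt_eqF.
  apply: (weighted_hall_sum (r := e)) => // [y Yy|s y Ss Yy esy].
    by apply: sumr_ge0 => s _; rewrite divr_ge0.
  have -> : inX s = \sum_(x in X | e x s) w (c x s y) / w y.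
    apply: eq_bigr => x /andP[Xx exs]; have [_ _ cw] := commute exs esy.
    by apply/eqP; rewrite eqr_div ?lt0r_neq0 // cw.
  apply: (sum_inj_le (f := fun v => w v / w y) (h := fun x => c x s y)) => [v||x x'].
  - by rewrite divr_ge0.
  - move=> x /andP[Xx exs]; have [_ evy _] := commute exs esy.
    by rewrite evy (mid _ _ _ Xx Ss).
  - by move=> /andP[_ exs] /andP[_ ex's]; apply: commute_injl.
(* [hall_down] and [out_le] give [E <= F]; [FE] is the reverse inequality that saturation asks
   for. *)
apply: (weighted_hall_saturated (r := fun s x => e x s) (p := outY) (q := outS)) => //.
- move=> x; rewrite inE => /andP[_ /exists_inP[s Ss exs]].
  by rewrite /outS (bigD1 s) ?Ss //= ltr_wpDr ?ltr01 // sumr_ge0.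
- by rewrite EE FF.
Qed.

Lemma min_cut_extremal : exists P : {set T}, min_cut P /\
  forall v, v \in boundary P -> (lev v == 0) || (k <= lev v)%N.
Proof.
(* After [n] rounds no boundary vertex has level strictly between [k - n] and [k]. *)
suff H n : exists P : {set T}, min_cut P /\
    forall v, v \in boundary P -> (lev v <= (k - n))%N || (k <= lev v)%N.
  have [P [mP bP]] := H k; exists P; split => // v /bP.
  by rewrite subnn leqn0.
elim: n => [|n [P [mP bP]]].
  have c0 : is_cut set0 by apply/forall_inP => v; rewrite inE.
  case: (@arg_minP _ _ _ set0 is_cut (fun P => weight (boundary P)) c0) => P cP mP.
  by exists P; split=> // v _; rewrite subn0 leq_total.
case: (boolP (0 < k - n < k)%N) => jk; last first.
  exists P; split => // v /bP; case: (leqP k (lev v)) => [_|vk]; rewrite ?orbT // !orbF.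
  by move: jk; rewrite negb_and -leqNgt -leqNgt; lia.
set j := (k - n)%N in jk bP.
set S := [set s in boundary P | lev s == j].
set X := [set x in P | [exists s in S, e x s]].
have XS : weight X <= weight S by apply: min_cut_pred_le.
have SB : S \subset boundary P by apply/subsetP => s; rewrite inE => /andP[].
have lev0 s : s \in S -> lev s != 0.
  by rewrite inE => /andP[_ /eqP ->]; case/andP: jk; rewrite -lt0n.
have bD := boundary_down SB lev0.
have [cP minP] := mP.
exists (P :\: X); split; first split.
- apply/forall_inP => v; rewrite inE => /andP[_ vP]; exact: (forall_inP cP).
- move=> Q cQ; apply: le_trans (minP Q cQ).
  apply: le_trans (weight_le bD) (le_trans (weightU _ _) _).
  by rewrite weightD // -/X; lra.
- move=> v /(subsetP bD); rewrite -/X in_setU => /orP[|].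
    rewrite in_setD => /andP[vS vB]; have := bP v vB.
    by move: vS; rewrite [v \in S]inE vB /= /j => vj; lia.
  rewrite inE => /andP[_ /exists_inP[s]]; rewrite inE => /andP[_ /eqP ls] exs.
  by have := levS exs; rewrite ls /j; lia.
Qed.
End MinimumCut.

Local Open Scope fset_scope.
Local Open Scope ring_scope.

(** * Sumsets as a commutative graph *)

Section Sumset.
Variable G : zmodType.
Implicit Types X Y Z : {fset G}.

Lemma sumsetP X Y z :
  reflect (exists2 x, x \in X & exists2 y, y \in Y & z = x + y) (z \in sumset X Y).
Proof.
apply: (iffP idP) => [/imfset2P[x /= Xx [y /= Yy ->]]|[x Xx [y Yy ->]]].
  by exists x => //; exists y.
by apply/imfset2P; exists x => //; exists y.
Qed.

Lemma mem_sumset X Y x y : x \in X -> y \in Y -> x + y \in sumset X Y.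
Proof. by move=> Xx Yy; apply/sumsetP; exists x => //; exists y. Qed.

Lemma sumsetC : commutative (@sumset G).
Proof.
move=> X Y; apply/fsetP => z; apply/sumsetP/sumsetP => -[x Xx [y Yy ->]];
by exists y => //; exists x => //; rewrite addrC.
Qed.

Lemma sumsetA : associative (@sumset G).
Proof.
move=> X Y Z; apply/fsetP => z; apply/sumsetP/sumsetP.
  move=> [x Xx [_ /sumsetP[y Yy [u Zu ->]] ->]].
  by exists (x + y); rewrite ?mem_sumset //; exists u; rewrite ?addrA.
move=> [_ /sumsetP[x Xx [y Yy ->]] [u Zu ->]].
by exists x => //; exists (y + u); rewrite ?mem_sumset ?addrA.
Qed.

Lemma sum0set : left_id [fset (0 : G)] (@sumset G).
Proof.
move=> X; apply/fsetP => z; apply/sumsetP/idP.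
  by move=> [_ /fset1P-> [y Yy ->]]; rewrite add0r.
by move=> Xz; exists 0; rewrite ?inE //; exists z; rewrite ?add0r.
Qed.

HB.instance Definition _ :=
  Monoid.isComLaw.Build {fset G} [fset 0] (@sumset G) sumsetA sumsetC sum0set.

Lemma sumsetSl X X' Y : X `<=` X' -> sumset X Y `<=` sumset X' Y.
Proof.
move=> XX'; apply/fsubsetP => _ /sumsetP[x Xx [y Yy ->]].
by rewrite mem_sumset // (fsubsetP XX').
Qed.

Lemma sumsetUl X X' Y : sumset (X `|` X') Y = sumset X Y `|` sumset X' Y.
Proof.
apply/eqP; rewrite eqEfsubset fsubUset !sumsetSl ?fsubsetUl ?fsubsetUr // !andbT.
apply/fsubsetP => _ /sumsetP[x + [y Yy ->]]; rewrite !inE.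
by case/orP => ?; apply/orP; [left|right]; apply: mem_sumset.
Qed.

Lemma sumset0l Y : sumset fset0 Y = fset0.
Proof. by apply/fsetP => z; rewrite inE; apply/sumsetP => -[x]; rewrite inE. Qed.

Variables (k : nat) (B : 'I_k -> {fset G}).

Lemma Bsum0 : Bsum B set0 = [fset 0].
Proof. by rewrite /Bsum big_set0. Qed.

Lemma BsumU1 i (I : {set 'I_k}) : i \notin I -> Bsum B (i |: I) = sumset (B i) (Bsum B I).
Proof. by move=> iI; rewrite /Bsum big_setU1. Qed.

Lemma sumset_Bsum0 X : sumset X (Bsum B set0) = X.
Proof. by rewrite Bsum0 sumsetC sum0set. Qed.

Lemma sumset_BsumU1 X i (I : {set 'I_k}) : i \notin I ->
  sumset X (Bsum B (i |: I)) = sumset (sumset X (Bsum B I)) (B i).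
Proof. by move=> iI; rewrite BsumU1 // -sumsetA [sumset (B i) _]sumsetC. Qed.

End Sumset.

(** * The weighted Plunnecke inequality for distinct summands *)

Section WeightedPlunnecke.
Variables (R : realFieldType) (G : zmodType) (k : nat).
Variables (A : {fset G}) (B : 'I_k -> {fset G}) (J : {set 'I_k}) (t : 'I_k -> R).
Hypothesis t_gt0 : forall i, 0 < t i.

Local Notation V I := (sumset A (Bsum B I)).

(** Pairing with the index set keeps the layers apart even where the sumsets share points of [G]. *)
Definition vertices : {fset G * {set 'I_k}} :=
  \bigcup_(I <- enum (powerset J)) [fset (x, I) | x in V I].

Lemma in_vertices x I : ((x, I) \in vertices) = (I \subset J) && (x \in V I).
Proof.
apply/bigfcupP/andP => [[I' ]|[IJ Vx]].
  by rewrite mem_enum powersetE andbT => I'J /imfsetP[y /= Vy [-> ->]].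
exists I; first by rewrite mem_enum powersetE IJ.
by apply/imfsetP; exists x.
Qed.

Local Notation pt := (fun v : vertices => (val v).1).
Local Notation idx := (fun v : vertices => (val v).2).

Definition edge (x y : vertices) :=
  [exists i, [&& i \notin idx x, idx y == i |: idx x & pt y - pt x \in B i]].
Definition level (v : vertices) := #|idx v|.
Definition vweight (v : vertices) : R := \prod_(i in idx v) t i.
(** The second step is made first, starting from [x]. Along two consecutive edges the default [s] of
    [insubd] never arises, by [val_swap]. *)
Definition swap (x s y : vertices) : vertices :=
  insubd s (pt x + (pt y - pt s), idx x :|: (idx y :\: idx s)).

Lemma vertexP (v : vertices) : (idx v \subset J) /\ (pt v \in V (idx v)).
Proof. by apply/andP; rewrite -in_vertices; case: v => -[]. Qed.

Lemma vweight_gt0 v : 0 < vweight v.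
Proof. by apply: prodr_gt0. Qed.

Lemma edgeP x y :
  reflect (exists i, [/\ i \notin idx x, idx y = i |: idx x & pt y - pt x \in B i])
          (edge x y).
Proof.
by apply: (iffP existsP) => -[i]; [move=> /and3P[? /eqP ? ?]|move=> [? /eqP ? ?]];
  exists i => //; apply/and3P.
Qed.

Lemma level_edge x y : edge x y -> level y = (level x).+1.
Proof. by move=> /edgeP[i [ix iy _]]; rewrite /level iy cardsU1 ix. Qed.

Lemma val_swap x s y : edge x s -> edge s y ->
  val (swap x s y) = (pt x + (pt y - pt s), idx x :|: (idx y :\: idx s)).
Proof.
move=> /edgeP[i [ix is_ bi]] /edgeP[p [ps py bp]].
rewrite val_insubd; have -> // : (pt x + (pt y - pt s), idx x :|: (idx y :\: idx s)) \in vertices.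
have yDs : idx y :\: idx s = [set p].
  by apply/setP => q; rewrite py !inE; case: eqP => [->|_] /=; rewrite ?ps ?andNb.
have px : p \notin idx x by apply: contraNN ps => px; rewrite is_ inE px orbT.
rewrite in_vertices yDs [idx x :|: _]setUC sumset_BsumU1 // mem_sumset //; last first.
  by case: (vertexP x).
rewrite andbT; apply: subset_trans (proj1 (vertexP y)).
by rewrite py is_ setUS // subsetUr.
Qed.

Lemma swap_commute x s y : edge x s -> edge s y ->
  [/\ edge x (swap x s y), edge (swap x s y) y &
      vweight (swap x s y) * vweight s = vweight x * vweight y].
Proof.
move=> xs sy; have sw := val_swap xs sy.
move: xs sy => /edgeP[i [ix is_ bi]] /edgeP[p [ps py bp]].
have yDs : idx y :\: idx s = [set p].
  by apply/setP => q; rewrite py !inE; case: eqP => [->|_] /=; rewrite ?ps ?andNb.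
have px : p \notin idx x by apply: contraNN ps => px; rewrite is_ inE px orbT.
have ip : i != p by apply: contraNneq ps => <-; rewrite is_ setU11.
split.
- apply/edgeP; exists p; rewrite sw yDs setUC; split => //=.
  by rewrite addrC addKr.
- apply/edgeP; exists i; rewrite sw yDs; split => /=.
  + by rewrite !inE negb_or ix ip.
  + by rewrite py is_ [idx x :|: _]setUC setUCA.
  + by have -> : pt y - (pt x + (pt y - pt s)) = pt s - pt x
      by rewrite !opprD opprK addrCA addNKr addrC.
- rewrite /vweight sw yDs py is_ [idx x :|: _]setUC /=.
  rewrite !big_setU1 //=; last by rewrite -is_.
  by ring.
Qed.

Lemma edge_sub x y : edge x y -> idx x \subset idx y.
Proof. by move=> /edgeP[i [_ -> _]]; apply: subsetUr. Qed.

Lemma vertex_inj (x y : vertices) : pt x = pt y -> idx x = idx y -> x = y.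
Proof.
move=> p i; apply: val_inj; move: p i.
by case: (val x) => ? ?; case: (val y) => ? ? /= -> ->.
Qed.

Lemma swap_injr x s y y' : edge x s -> edge s y -> edge s y' ->
  swap x s y = swap x s y' -> y = y'.
Proof.
move=> xs sy sy' /(congr1 val); rewrite !val_swap // => -[/addrI/addIr ep ei].
have idxE z : edge s z -> idx z = idx s :|: (idx x :|: (idx z :\: idx s)).
  move=> sz; rewrite setUA (setUidPl (edge_sub xs)) -(setUidPr (edge_sub sz)).
  by apply/setP => q; rewrite !inE; case: (q \in idx s).
by apply: vertex_inj => //; rewrite (idxE _ sy) (idxE _ sy') ei.
Qed.

Lemma swap_injl x x' s y : edge x s -> edge x' s -> edge s y ->
  swap x s y = swap x' s y -> x = x'.
Proof.
move=> xs x's sy /(congr1 val); rewrite !val_swap // => -[/addIr ep ei].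
have idxE z : edge z s -> idx z = (idx z :|: (idx y :\: idx s)) :&: idx s.
  move=> zs; rewrite -[LHS](setIidPl (edge_sub zs)).
  by apply/setP => q; rewrite !inE; case: (q \in idx s); rewrite ?andbF // orbF.
by apply: vertex_inj => //; rewrite (idxE _ xs) (idxE _ x's) ei.
Qed.

Lemma card_fiber_ge (S : {set vertices}) (I : {set 'I_k}) (X : {fset G}) :
  (forall z, z \in X -> exists2 v, v \in S & val v = (z, I)) ->
  (#|` X| <= #|[set v in S | idx v == I]|)%N.
Proof.
move=> XS; pose F := [set v in S | idx v == I].
have : X `<=` [fset pt v | v in F].
  apply/fsubsetP => z /XS[v vS vE]; apply/imfsetP; exists v; rewrite /= ?vE //.
  by rewrite inE vS vE eqxx.
move=> /fsubset_leq_card/leq_trans; apply; rewrite -/F cardE.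
exact: leq_trans (leq_imfset_card _ _ _) _.
Qed.

Lemma card_fiber_le (S : {set vertices}) (I : {set 'I_k}) :
  (#|[set v in S | idx v == I]| <= #|` V I|)%N.
Proof.
set F := [set v in S | idx v == I].
rewrite cardE -(size_map (fun v : vertices => pt v)) uniq_leq_size //.
  rewrite map_inj_in_uniq ?enum_uniq // => u v.
  rewrite !mem_enum !inE => /andP[_ /eqP uI] /andP[_ /eqP vI] p.
  by apply: vertex_inj => //; rewrite uI vI.
move=> _ /mapP[v + ->]; rewrite mem_enum inE => /andP[_ /eqP <-].
exact: (proj2 (vertexP v)).
Qed.

Lemma weight_fibers (S : {set vertices}) :
  weight vweight S =
  \sum_(I : {set 'I_k}) (\prod_(i in I) t i) * #|[set v in S | idx v == I]|%:R.
Proof.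
rewrite /weight (partition_big idx predT) //=; apply: eq_bigr => I _.
rewrite -sum1_card natr_sum mulr_sumr; apply: eq_big => v; first by rewrite inE.
by move=> /andP[_ /eqP vI]; rewrite mulr1 /vweight vI.
Qed.

(** Two cuts are compared: the extremal minimum cut, whose boundary contains [A] without [Z] on the
    first layer and [Z + B_J] on the last, so that [expand] makes it weigh at least [#|A|]; and the
    cut along layer [l]. *)
Lemma weighted_plunnecke (l : nat) : (0 < l <= #|J|)%N ->
  (forall Z, Z `<=` A ->
     #|` Z|%:R <= (\prod_(i in J) t i) * #|` sumset Z (Bsum B J)|%:R) ->
  #|` A|%:R <= \sum_(L : {set 'I_k} | (L \subset J) && (#|L| == l))
                 (\prod_(i in L) t i) * #|` V L|%:R.
Proof.
move=> /andP[l0 lJ] expand.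
have [P [[cP minP] bP]] := min_cut_extremal #|J| vweight_gt0 level_edge
  swap_commute swap_injr swap_injl.
pose Z := [fset x in A | [exists v in P, val v == (x, set0)]].
have ZA : Z `<=` A by apply/fsubsetP => x; rewrite !inE => /andP[].
(* A path from [Z] can leave [P] only through the boundary, which has no vertex on intermediate
   levels. It stays in [P] until level [#|J|], which [P] avoids. *)
have reach (n : nat) (I : {set 'I_k}) (z : G) : #|I| = n ->
    I \subset J -> z \in sumset Z (Bsum B I) ->
    exists2 v, v \in (if (n < #|J|)%N then P else boundary edge level P) & val v = (z, I).
  elim: n I z => [|n IHn] I z cI IJ.
    rewrite (cards0_eq cI) sumset_Bsum0 !inE => /andP[_ /exists_inP[v vP /eqP vE]].
    by exists v; rewrite // (leq_trans l0 lJ).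
  have [i iI] : exists i, i \in I by apply/set0Pn; rewrite -card_gt0 cI.
  have IE : I = i |: (I :\ i) by rewrite setD1K.
  have iI' : i \notin I :\ i by rewrite setD11.
  have cI' : #|I :\ i| = n by move: cI; rewrite (cardsD1 i) iI => -[].
  have I'J : I :\ i \subset J by apply: subset_trans IJ; apply: subD1set.
  have nJ : (n < #|J|)%N by rewrite -cI subset_leq_card.
  rewrite {1}IE sumset_BsumU1 // => /sumsetP[z' z'Z [b bB zE]].
  have [u] := IHn _ _ cI' I'J z'Z; rewrite nJ => uP uE.
  have zV : (z, I) \in vertices.
    rewrite in_vertices IJ {1}IE sumset_BsumU1 // zE mem_sumset //.
    by apply: (fsubsetP (sumsetSl _ ZA)).
  pose v : vertices := [` zV].
  have uv : edge u v.
    apply/edgeP; exists i; rewrite uE /=; split => //.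
    by rewrite zE addrC addKr.
  have vPB : v \notin P -> v \in boundary edge level P.
    by move=> vP; rewrite inE vP /=; apply/orP; right; apply/exists_inP; exists u.
  have lv : level v = n.+1 by rewrite /level /= cI.
  exists v => //; case: ltnP => nJ'.
    by apply/negPn/negP => /vPB/bP; rewrite lv /= leqNgt nJ'.
  by apply: vPB; apply/negP => /(forall_inP cP); rewrite lv eqn_leq nJ nJ'.
(* Since [0 < l], all of level 0 lies in [Pl], so the boundary is confined to level [l]. *)
pose Pl := [set v | (level v < l)%N].
have cPl : is_cut level #|J| Pl.
  by apply/forall_inP => v; rewrite inE; lia.
have bPl v : v \in boundary edge level Pl -> level v = l.
  rewrite !inE -leqNgt => /andP[lv /orP[/eqP|/exists_inP[x]]]; first by lia.
  by rewrite inE => lx /level_edge; lia.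
have J0 : set0 != J by rewrite eq_sym -card_gt0; lia.
have term_ge0 (I : {set 'I_k}) (n : nat) : 0 <= (\prod_(i in I) t i) * n%:R.
  by rewrite mulr_ge0 // prodr_ge0 // => i _; rewrite ltW.
have lower : #|` A|%:R <= weight vweight (boundary edge level P).
  rewrite weight_fibers (bigD1 set0) //= (bigD1 J) 1?eq_sym //= addrA.
  rewrite -[leLHS]addr0 lerD ?sumr_ge0 //.
  have -> : #|` A|%:R = #|` A `\` Z|%:R + #|` Z|%:R :> R.
    by rewrite -natrD cardfsD (fsetIidPr ZA) subnK // fsubset_leq_card.
  apply: lerD.
    rewrite big_set0 mul1r ler_nat; apply: card_fiber_ge => z.
    rewrite !inE => /andP[zZ zA].
    have zV : (z, set0) \in vertices by rewrite in_vertices sub0set sumset_Bsum0.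
    exists [` zV] => //; rewrite inE /level /= cards0 andbT.
    by apply: contra zZ => vP; rewrite zA /=; apply/exists_inP; exists [` zV].
  apply: le_trans (expand _ ZA) _; rewrite ler_pM2l ?prodr_gt0 // ler_nat.
  apply: card_fiber_ge => z zZ.
  by have := reach _ _ _ erefl (subxx J) zZ; rewrite ltnn.
apply: le_trans lower (le_trans (minP _ cPl) _).
rewrite weight_fibers [leRHS]big_mkcond /=; apply: ler_sum => I _.
case: ifP => [_|nI].
  rewrite ler_pM2l ?prodr_gt0 // ler_nat; exact: card_fiber_le.
have -> : [set v in boundary edge level Pl | idx v == I] = set0.
  apply/setP => v; rewrite [RHS]inE [LHS]inE; apply/negP => /andP[/bPl vl /eqP vI].
  by move: nI; rewrite -vI -/(level v) vl eqxx andbT (proj1 (vertexP v)).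
by rewrite cards0 mulr0.
Qed.

End WeightedPlunnecke.

(** * Passing from l to l + 1 summands *)

Lemma big_codim1 (T : Type) (idx : T) (op : Monoid.com_law idx) (I : finType)
    (J : {set I}) (l : nat) (F : {set I} -> T) : #|J| = l.+1 ->
  \big[op/idx]_(L : {set I} | (L \subset J) && (#|L| == l)) F L =
  \big[op/idx]_(i in J) F (J :\ i).
Proof.
move=> cJ.
have injD : {in J &, injective (fun i => J :\ i)}.
  move=> i i' iJ i'J /setP/(_ i); rewrite !inE eqxx iJ andbT /=.
  by case: eqP.
rewrite -(big_imset _ injD) /=; apply: eq_bigl => L; apply/andP/imsetP.
  move=> [LJ /eqP cL]; have /cards1P[i iE] : #|J :\: L| == 1.
    by rewrite cardsD (setIidPr LJ) cJ cL subSnn.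
  have : i \in J :\: L by rewrite iE set11.
  rewrite inE => /andP[iL iJ]; exists i => //; apply/setP => q.
  by rewrite -iE !inE; case: (boolP (q \in L)) => [/(subsetP LJ)->|_]; case: (q \in J).
move=> [i iJ ->]; split; first exact: subD1set.
by move: cJ; rewrite (cardsD1 i) iJ add1n => -[->].
Qed.

Section Nonempty.
Variables (R : realType) (G : zmodType) (k : nat) (B : 'I_k -> {fset G}).
Implicit Types (A X : {fset G}) (I J L : {set 'I_k}).

Lemma sumset_neq0 (X Y : {fset G}) : X != fset0 -> Y != fset0 -> sumset X Y != fset0.
Proof.
by move=> /fset0Pn[x Xx] /fset0Pn[y Yy]; apply/fset0Pn; exists (x + y); apply: mem_sumset.
Qed.

Lemma Bsum_neq0 I : (forall i, i \in I -> B i != fset0) -> Bsum B I != fset0.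
Proof.
move=> BI; apply: (big_ind (fun Y => Y != fset0)) => //; last exact: sumset_neq0.
by apply/fset0Pn; exists 0; rewrite inE.
Qed.

Lemma Bsum_eq0 I i : i \in I -> B i = fset0 -> Bsum B I = fset0.
Proof. by move=> iI Bi; rewrite -(setD1K iI) BsumU1 ?setD11 // Bi sumset0l. Qed.

Lemma card_gt0R (X : {fset G}) : X != fset0 -> 0 < #|` X|%:R :> R.
Proof. by move=> X0; rewrite ltr0n cardfs_gt0. Qed.

Lemma alpha_ge0 A I : 0 <= alpha R A B I.
Proof. by rewrite /alpha divr_ge0. Qed.

Lemma alpha_mul A I : A != fset0 ->
  alpha R A B I * #|` A|%:R = #|` sumset A (Bsum B I)|%:R.
Proof. by move=> A0; rewrite /alpha divfK // gt_eqF // card_gt0R. Qed.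

Lemma alpha_sub A X I (d : R) : X `<=` A -> X != fset0 -> 0 < d ->
  d * #|` A|%:R <= #|` X|%:R -> alpha R X B I <= alpha R A B I / d.
Proof.
move=> XA X0 d0 dX; have A0 : A != fset0.
  by move: X0; apply: contraNneq => A0; rewrite -fsubset0 -A0.
rewrite /alpha ler_pdivrMr ?card_gt0R // -!mulrA.
apply: (@le_trans _ _ #|` sumset A (Bsum B I)|%:R).
  by rewrite ler_nat fsubset_leq_card // sumsetSl.
rewrite ler_peMr // mulrA -invfM mulrC ler_pdivlMr ?mulr_gt0 ?card_gt0R //.
by rewrite mul1r mulrC.
Qed.

(** [X] minimises the ratio over nonempty subsets, which yields the hypothesis of
    [weighted_plunnecke] for weights whose product is the inverse of the minimum. Nonempty [B i]
    keep every [alpha] involved positive, so the weights can be balanced. *)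
Lemma exists_small_expansion A J (l : nat) : (0 < l)%N -> #|J| = l.+1 ->
  A != fset0 -> (forall i, i \in J -> B i != fset0) ->
  exists X, [/\ X `<=` A, X != fset0 &
    (#|` sumset X (Bsum B J)|%:R / #|` X|%:R) ^+ l <=
    l.+1%:R ^+ l.+1 *
      \prod_(L : {set 'I_k} | (L \subset J) && (#|L| == l)) alpha R A B L].
Proof.
move=> l0 cJ A0 BJ.
have AA : A \in fpowerset A by rewrite fpowersetE.
pose ratio (X : {fset G}) : R := #|` sumset X (Bsum B J)|%:R / #|` X|%:R.
case: (@arg_minP _ _ (fpowerset A) [` AA] (fun Y => val Y != fset0)
        (fun Y => ratio (val Y)) A0) => X /= X0 minX.
have XA : val X `<=` A by rewrite -fpowersetE; apply: valP.
exists (val X); split=> //; rewrite -/(ratio _) big_codim1 //.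
have [w w0 wE] : exists2 w, 0 < w & ratio (val X) = w^-1.
  exists (ratio (val X))^-1; rewrite ?invrK // invr_gt0 divr_gt0 // card_gt0R //.
  by rewrite sumset_neq0 // Bsum_neq0.
pose a i := alpha R A B (J :\ i).
have a0 i : 0 < a i.
  rewrite divr_gt0 // card_gt0R // sumset_neq0 // Bsum_neq0 // => i' .
  by rewrite inE => /andP[_ /BJ].
(* With these weights every [J :\ i] contributes [d * #|A|] to the weighted
   inequality, while the weight of [J] is exactly [w]. *)
pose d := (w ^+ l * \prod_(i in J) a i) `^ (l.+1%:R^-1).
have prod0 : 0 < w ^+ l * \prod_(i in J) a i.
  by rewrite mulr_gt0 ?exprn_gt0 ?prodr_gt0.
have d0 : 0 < d by rewrite powR_gt0.
have dX : d ^+ l.+1 = w ^+ l * \prod_(i in J) a i.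
  by rewrite -powR_mulrn ?ltW // /d -powRrM mulVf ?powRr1 ?ltW // pnatr_eq0.
pose t i := w * a i / d.
have t0 i : 0 < t i by rewrite /t divr_gt0 // mulr_gt0.
have tJ : \prod_(i in J) t i = w.
  rewrite /t big_split /= big_split /= !prodr_const cJ exprVn dX exprS.
  by field; rewrite ?gt_eqF ?prodr_gt0 ?exprn_gt0.
have tD i : i \in J -> \prod_(i' in J :\ i) t i' = d / a i.
  move=> iJ; have := tJ; rewrite (big_setD1 i) //= => tJ'.
  apply: (mulfI (lt0r_neq0 (t0 i))); rewrite tJ' /t.
  by field; rewrite ?gt_eqF.
have lJ : (0 < l <= #|J|)%N by rewrite l0 cJ leqnSn.
have expand Z : Z `<=` A -> #|` Z|%:R <= w * #|` sumset Z (Bsum B J)|%:R.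
  move=> ZA; have [->|Z0] := eqVneq Z fset0; first by rewrite cardfs0 mulr_ge0 // ltW.
  have ZP : Z \in fpowerset A by rewrite fpowersetE.
  have := minX [` ZP] Z0; rewrite /= wE /ratio.
  by rewrite ler_pdivlMr ?card_gt0R // ler_pdivrMl.
have := weighted_plunnecke (A := A) (B := B) t0 lJ.
rewrite tJ big_codim1 // => /(_ expand).
have -> : \sum_(i in J) \prod_(i' in J :\ i) t i' * #|` sumset A (Bsum B (J :\ i))|%:R =
    l.+1%:R * d * #|` A|%:R.
  rewrite -cJ -sum1_card natr_sum !mulr_suml; apply: eq_bigr => i iJ.
  by rewrite tD // -alpha_mul // -/(a i) mulrA divfK ?gt_eqF // mul1r.
rewrite -[leLHS]mul1r ler_pM2r ?card_gt0R // => ld.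
(* The power [l.+1] removes the root in [d], leaving [w ^+ l], the inverse of the left side of the
   claim. *)
have : 1 <= (l.+1%:R * d) ^+ l.+1 by rewrite exprn_ege1.
rewrite exprMn dX wE exprVn => ?.
by rewrite -[leLHS]mulr1 ler_pdivrMl ?exprn_gt0 // mulrCA.
Qed.

End Nonempty.

(** * Large subsets and induction on the number of summands *)

Section LargeControl.
Variables (R : realType) (k : nat).
Implicit Types (I J L : {set 'I_k}).

Definition beta_exp (l : nat) (J : {set 'I_k}) : R :=
  ((l.-1)`! * (#|J| - l)`!)%:R / ((#|J|).-1)`!%:R.

Lemma beta_exp_ge0 l J : 0 <= beta_exp l J.
Proof. by rewrite divr_ge0. Qed.

Lemma beta_ge0 l (G : zmodType) (A : {fset G}) (B : 'I_k -> {fset G}) J :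
  0 <= beta R l A B J.
Proof. exact: powR_ge0. Qed.

Lemma prod_alpha_ge0 (G : zmodType) (A : {fset G}) (B : 'I_k -> {fset G})
    (P : pred {set 'I_k}) : 0 <= \prod_(L | P L) alpha R A B L.
Proof. by apply: prodr_ge0 => L _; apply: alpha_ge0. Qed.

Lemma beta_base l (G : zmodType) (A : {fset G}) (B : 'I_k -> {fset G}) J :
  #|J| = l -> beta R l A B J = alpha R A B J.
Proof.
move=> cJ; rewrite /beta cJ subnn muln1 divff ?pnatr_eq0 -?lt0n ?fact_gt0 //.
rewrite powRr1 ?prod_alpha_ge0 // (big_pred1 J) // => L /=.
apply/andP/eqP => [[LJ /eqP cL]|->]; last by rewrite cJ.
by apply/eqP; rewrite eqEcard LJ cJ cL leqnn.
Qed.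

(** The exponent is [(l-1)! 1! / l! = 1 / l]. *)
Lemma beta_step l (G : zmodType) (A : {fset G}) (B : 'I_k -> {fset G}) J :
  (0 < l)%N -> #|J| = l.+1 ->
  beta R l A B J = (\prod_(i in J) alpha R A B (J :\ i)) `^ l%:R^-1.
Proof.
move=> l0 cJ; rewrite /beta cJ big_codim1 // subSnn muln1; congr powR.
rewrite -[in (l.+1.-1)`!](prednK l0) /= factS prednK // natrM invfM mulrCA divff ?mulr1 //.
by rewrite pnatr_eq0 -lt0n fact_gt0.
Qed.

Lemma powR_prod (I : finType) (P : pred I) (F : I -> R) (r : R) :
  (forall i, 0 <= F i) -> \prod_(i | P i) (F i `^ r) = (\prod_(i | P i) F i) `^ r.
Proof.
move=> F0.
suff [] : 0 <= \prod_(i | P i) F i /\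
          \prod_(i | P i) (F i `^ r) = (\prod_(i | P i) F i) `^ r by [].
apply: (big_ind2 (fun x y => 0 <= x /\ y = x `^ r)).
- by rewrite powR1 ler01.
- by move=> x1 y1 x2 y2 [h1 ->] [h2 ->]; rewrite powRM // mulr_ge0.
- by move=> i _; split.
Qed.

(** Each [L] of size [l] in [J] lies in [J :\ i] for [j + 1 - l] indices [i] of [J], and multiplying
    the exponent [(l-1)! (j-l)! / (j-1)!] by [(j + 1 - l) / j] gives [(l-1)! (j+1-l)! / j!]. *)
Lemma beta_codim1 l (G : zmodType) (A : {fset G}) (B : 'I_k -> {fset G}) J j :
  (0 < l <= j)%N -> #|J| = j.+1 ->
  (\prod_(i in J) beta R l A B (J :\ i)) `^ j%:R^-1 = beta R l A B J.
Proof.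
move=> /andP[l0 lj] cJ.
have cJi i : i \in J -> #|J :\ i| = j.
  by move=> iJ; move: cJ; rewrite (cardsD1 i) iJ add1n => -[->].
have j0 : (0 < j)%N by apply: leq_trans lj.
pose e : R := ((l.-1)`! * (j - l)`!)%:R / (j.-1)`!%:R.
pose Q i := \prod_(L : {set 'I_k} | (L \subset J :\ i) && (#|L| == l)) alpha R A B L.
have -> : \prod_(i in J) beta R l A B (J :\ i) = \prod_(i in J) (Q i `^ e).
  by apply: eq_bigr => i iJ; rewrite /beta cJi.
rewrite powR_prod => [|i]; last exact: prod_alpha_ge0.
have -> : \prod_(i in J) Q i =
    (\prod_(L : {set 'I_k} | (L \subset J) && (#|L| == l)) alpha R A B L) ^+ (j.+1 - l).
  rewrite /Q (exchange_big_dep (fun L => (L \subset J) && (#|L| == l))) /=; last first.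
    by move=> i L iJ /andP[/subset_trans -> //]; apply: subD1set.
  rewrite -prodrXl; apply: eq_bigr => L /andP[LJ /eqP cL].
  have -> : (j.+1 - l)%N = #|J :\: L| by rewrite cardsD (setIidPr LJ) cJ cL.
  rewrite -prodr_const; apply: eq_bigl => i.
  by rewrite cL eqxx andbT subsetD1 LJ /= inE andbC.
rewrite -powR_mulrn ?prod_alpha_ge0 // -!powRrM /beta cJ; congr powR.
rewrite /e; case: j {cJ cJi e} j0 lj => // j _ lj /=.
rewrite subSn // !factS !natrM; field.
by rewrite pnatr_eq0 -lt0n fact_gt0 /= nat1r pnatr_eq0.
Qed.

(** Each of the [N] factors [alpha] grows by at most [1 / d], by [alpha_sub]; the exponent of [beta]
    carries over to the constant. *)
Lemma beta_sub l J (d : R) : 0 < d -> exists2 c : R, 0 <= c &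
  forall (G : zmodType) (A X : {fset G}) (B : 'I_k -> {fset G}),
    X `<=` A -> X != fset0 -> d * #|` A|%:R <= #|` X|%:R ->
    beta R l X B J <= c * beta R l A B J.
Proof.
move=> d0; pose N := #|[set L : {set 'I_k} | (L \subset J) && (#|L| == l)]|.
exists ((d^-1 ^+ N) `^ beta_exp l J) => [|G A X B XA X0 dX]; first exact: powR_ge0.
rewrite /beta -/(beta_exp l J) -powRM ?prod_alpha_ge0 ?exprn_ge0 ?invr_ge0 ?(ltW d0) //.
apply: ge0_ler_powR; rewrite ?nnegrE ?beta_exp_ge0 ?prod_alpha_ge0 //.
  by rewrite mulr_ge0 ?prod_alpha_ge0 ?exprn_ge0 ?invr_ge0 ?ltW.
rewrite -prodr_const; under [X in _ <= X * _]eq_bigl do rewrite inE.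
rewrite -big_split; apply: ler_prod => L _; rewrite alpha_ge0 /= mulrC.
exact: alpha_sub.
Qed.

(** The constant precedes the group and the sets, and [eps] is quantified inside so that inductions
    can spend [eps / 2] per stage. *)
Definition large_control (l : nat) (J : {set 'I_k}) := forall eps : R,
  0 < eps -> eps < 1 -> exists2 c : R, 0 <= c &
  forall (G : zmodType) (A : {fset G}) (B : 'I_k -> {fset G}), A != fset0 ->
  exists X : {fset G}, [/\ X `<=` A, (1 - eps) * #|` A|%:R < #|` X|%:R &
    #|` sumset X (Bsum B J)|%:R <= c * beta R l A B J * #|` X|%:R].

(* Take [X] maximal among the subsets with the required growth; if it missed
   [eps * #|A|] points, a well-behaved subset of [A `\` X] could be added. *)
Lemma large_control_codim1 l J : (0 < l)%N -> #|J| = l.+1 -> large_control l J.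
Proof.
move=> l0 cJ eps eps0 eps1.
(* The first factor comes from [exists_small_expansion]; each of the [l.+1] factors [alpha] costs
   [1 / eps] when [A] is replaced by a subset of relative size at least [eps]. *)
pose C : R := l.+1%:R ^+ l.+1 * eps^-1 ^+ l.+1.
have C0 : 0 <= C by rewrite mulr_ge0 ?exprn_ge0 ?invr_ge0 ?ltW.
exists (C `^ l%:R^-1) => [|G A B A0]; first exact: powR_ge0.
have l_neq0 : l%:R != 0 :> R by rewrite pnatr_eq0 -lt0n.
set g := C `^ l%:R^-1 * beta R l A B J.
have g0 : 0 <= g by rewrite mulr_ge0 ?powR_ge0.
have gX : g ^+ l = C * \prod_(i in J) alpha R A B (J :\ i).
  rewrite /g beta_step // -powRM ?prodr_ge0 //; last by move=> i _; apply: alpha_ge0.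
  rewrite -powR_mulrn ?powR_ge0 // -powRrM mulVf // powRr1 // mulr_ge0 //.
  by apply: prodr_ge0 => i _; apply: alpha_ge0.
(* If some [B i] is empty, so is [Bsum B J], and [A] itself serves. *)
have [BJ|] := boolP [forall i in J, B i != fset0]; last first.
  rewrite negb_forall_in => /exists_inP[i iJ]; rewrite negbK => /eqP Bi.
  exists A; split=> //.
    by rewrite gtr_pMl ?card_gt0R // ltrBlDr ltrDl.
  by rewrite (Bsum_eq0 iJ Bi) sumsetC sumset0l cardfs0 mulr_ge0.
have {}BJ i : i \in J -> B i != fset0 by move/(forall_inP BJ).
pose good (X : {fset G}) := (#|` sumset X (Bsum B J)|%:R <= g * #|` X|%:R :> R).
have good0 : good fset0 by rewrite /good sumset0l cardfs0 mulr0.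
have f0 : fset0 \in fpowerset A by rewrite fpowersetE fsub0set.
case: (@arg_maxnP (fpowerset A) [` f0] (fun Y => good (val Y))
         (fun Y => #|` val Y|) good0) => X /= goodX maxX.
have XA : val X `<=` A by rewrite -fpowersetE; apply: valP.
exists (val X); split=> //; rewrite ltNge; apply/negP => small.
pose A' := A `\` val X.
have cA' : #|` A'|%:R = #|` A|%:R - #|` val X|%:R :> R.
  by rewrite /A' cardfsD (fsetIidPr XA) natrB // fsubset_leq_card.
have big : eps * #|` A|%:R <= #|` A'|%:R by rewrite cA'; lra.
have A'0 : A' != fset0.
  by rewrite -cardfs_gt0 -(ltr0n R) (lt_le_trans _ big) // mulr_gt0 // card_gt0R.
have A'A : A' `<=` A by apply: fsubsetDl.
have [X' [X'A' X'0]] := exists_small_expansion R l0 cJ A'0 BJ.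
rewrite big_codim1 // => le_ratio.
have goodX' : good X'.
  rewrite /good -ler_pdivrMr ?card_gt0R // -(ler_pXn2r l0) ?nnegrE ?divr_ge0 //.
  apply: le_trans le_ratio _; rewrite gX /C -mulrA ler_pM2l ?exprn_gt0 //.
  rewrite -cJ -prodr_const -big_split; apply: ler_prod => i _.
  by rewrite alpha_ge0 /= mulrC alpha_sub.
have UA : val X `|` X' \in fpowerset A.
  by rewrite fpowersetE fsubUset XA (fsubset_trans X'A').
have disj : #|` val X `|` X'| = (#|` val X| + #|` X'|)%N.
  rewrite cardfsU; have -> : val X `&` X' = fset0; last by rewrite cardfs0 subn0.
  apply/fsetP => x; rewrite !inE; apply/negP => /andP[xX /(fsubsetP X'A')].
  by rewrite inE xX.
(* The sets are disjoint, so their sizes add, while the sumset of the union is at most as large as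
   the two sumsets together. *)
have goodU : good (val X `|` X').
  rewrite /good disj sumsetUl natrD mulrDr.
  apply: le_trans (lerD goodX goodX'); rewrite -natrD ler_nat.
  by rewrite cardfsU leq_subr.
have := maxX [` UA] goodU; rewrite /= disj -[leqRHS]addn0 leq_add2l.
by rewrite leqn0 cardfs_eq0 (negPf X'0).
Qed.

(** The sets [J] are treated in turn, each time passing to a dense subset; bounds already obtained
    survive up to a constant factor. *)
Lemma large_control_all l (s : seq {set 'I_k}) :
  (forall J, J \in s -> large_control l J) -> forall eps : R,
  0 < eps -> eps < 1 -> exists2 c : R, 0 <= c &
  forall (G : zmodType) (A : {fset G}) (B : 'I_k -> {fset G}), A != fset0 ->
  exists X : {fset G}, [/\ X `<=` A, (1 - eps) * #|` A|%:R < #|` X|%:R &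
    forall J, J \in s ->
      #|` sumset X (Bsum B J)|%:R <= c * beta R l A B J * #|` X|%:R].
Proof.
elim: s => [|J s IHs] ctl eps eps0 eps1.
  exists 0 => // G A B A0; exists A; split=> //.
  by rewrite gtr_pMl ?card_gt0R // ltrBlDr ltrDl.
have h0 : 0 < eps / 2 by lra.
have h1 : eps / 2 < 1 by lra.
have [J' J's|c1 c10 ctl1] := IHs _ _ h0 h1; first by apply: ctl; rewrite inE J's orbT.
have [|c2 c20 ctl2] := ctl J _ _ h0 h1; first by rewrite inE eqxx.
have d0 : 0 < 1 - eps / 2 by lra.
have [c3 c30 ctl3] := beta_sub l J d0.
(* The first term covers the earlier sets, where [#|X1|] is traded for [#|X|]. The second covers
   [J], with [c3] turning [beta] of [X1] into [beta] of [A]. *)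
exists (c1 / (1 - eps / 2) + c2 * c3).
  by rewrite addr_ge0 ?mulr_ge0 ?invr_ge0 ?(ltW d0).
move=> G A B A0; have [X1 [X1A cX1 bX1]] := ctl1 G A B A0.
have A_gt0 : 0 < #|` A|%:R :> R by apply: card_gt0R.
have X10 : X1 != fset0.
  by rewrite -cardfs_gt0 -(ltr0n R) (lt_trans _ cX1) // mulr_gt0.
have [X [XX1 cX bX]] := ctl2 G X1 B X10.
exists X; split; first exact: fsubset_trans X1A.
  apply: le_lt_trans cX; apply: (@le_trans _ _ ((1 - eps / 2) * ((1 - eps / 2) * #|` A|%:R))).
    rewrite mulrA ler_pM2r //; nra.
  by rewrite ler_pM2l // ltW.
move=> J'; rewrite inE => /orP[/eqP ->|J's].
  apply: le_trans bX _; rewrite ler_wpM2r // mulrDl -mulrA.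
  rewrite ler_wpDl ?mulr_ge0 ?invr_ge0 ?beta_ge0 ?(ltW d0) //.
  by rewrite -mulrA ler_wpM2l // ctl3 // ltW.
apply: (@le_trans _ _ (#|` sumset X1 (Bsum B J')|%:R)).
  by rewrite ler_nat fsubset_leq_card // sumsetSl.
apply: le_trans (bX1 _ J's) _.
apply: (@le_trans _ _ (c1 * beta R l A B J' * (#|` X|%:R / (1 - eps / 2)))).
  by rewrite ler_wpM2l ?mulr_ge0 ?beta_ge0 // ler_pdivlMr // mulrC (ltW cX).
rewrite [_ / (1 - _)]mulrC mulrA ler_wpM2r // mulrDl mulrAC lerDl.
by rewrite !mulr_ge0 ?beta_ge0.
Qed.

(** Induction on [#|J| - l]: some [X1] controls all the [J :\ i] at once, then the codimension-one
    case, with [#|J| - 1] for [l], is applied to [X1], and [beta_codim1] recombines the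
    exponents. *)
Lemma large_control_holds l J : (0 < l <= #|J|)%N -> large_control l J.
Proof.
move=> /andP[l0 /subnKC]; move: (#|J| - l)%N => j /esym.
elim: j J => [|j IHj] J cJ.
  rewrite addn0 in cJ; move=> eps eps0 eps1; exists 1 => // G A B A0; exists A; split=> //.
    by rewrite gtr_pMl ?card_gt0R // ltrBlDr ltrDl.
  by rewrite mul1r beta_base // alpha_mul.
move=> eps eps0 eps1; rewrite addnS in cJ.
have h0 : 0 < eps / 2 by lra.
have h1 : eps / 2 < 1 by lra.
have cJi i : i \in J -> #|J :\ i| = (l + j)%N.
  by move=> iJ; move: cJ; rewrite (cardsD1 i) iJ add1n => -[->].
have [|c1 c10 ctl1] := @large_control_all l [seq J :\ i | i <- enum J] _ _ h0 h1.
  by move=> _ /mapP[i + ->]; rewrite mem_enum => /cJi/IHj.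
have lj0 : (0 < l + j)%N by rewrite addn_gt0 l0.
have [c2 c20 ctl2] := large_control_codim1 lj0 cJ h0 h1.
(* There is one [c1] for each [i] in [J], under the root of [beta_step]. *)
exists (c2 * (c1 ^+ (l + j).+1) `^ (l + j)%:R^-1) => [|G A B A0].
  by rewrite mulr_ge0 ?powR_ge0.
have [X1 [X1A cX1 bX1]] := ctl1 G A B A0.
have A_gt0 : 0 < #|` A|%:R :> R by apply: card_gt0R.
have X10 : X1 != fset0.
  by rewrite -cardfs_gt0 -(ltr0n R) (lt_trans _ cX1) // mulr_gt0 //; lra.
have [X [XX1 cX bX]] := ctl2 G X1 B X10.
exists X; split; first exact: fsubset_trans X1A.
  apply: le_lt_trans cX; apply: (@le_trans _ _ ((1 - eps / 2) * ((1 - eps / 2) * #|` A|%:R))).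
    rewrite mulrA ler_pM2r //; nra.
  by rewrite ler_pM2l ?ltW //; lra.
apply: le_trans bX _; rewrite ler_wpM2r // -mulrA ler_wpM2l //.
rewrite beta_step // -(beta_codim1 A B (l := l) _ cJ) ?l0 ?leq_addr //.
have prod_ge0 : 0 <= \prod_(i in J) beta R l A B (J :\ i).
  by apply: prodr_ge0 => i _; apply: beta_ge0.
rewrite -powRM ?exprn_ge0 //.
apply: ge0_ler_powR; rewrite ?nnegrE ?invr_ge0 ?mulr_ge0 ?exprn_ge0 //.
  by apply: prodr_ge0 => i _; apply: alpha_ge0.
rewrite -cJ -prodr_const -big_split; apply: ler_prod => i iJ.
rewrite alpha_ge0 /= /alpha ler_pdivrMr ?card_gt0R // bX1 //.
by apply/mapP; exists i; rewrite ?mem_enum.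
Qed.

End LargeControl.

Local Open Scope fset_scope.

Theorem theorem5 (R : realType) (k l : nat) (eps : R) :
  (0 < l)%N -> (l < k)%N -> 0 < eps -> eps < 1 ->
  exists c : R,
    forall (G : zmodType) (A : {fset G}) (B : 'I_k -> {fset G}),
      A != fset0 ->
      exists X : {fset G},
        [/\ X `<=` A,
            (1 - eps) * #|` A|%:R < #|` X|%:R &
            forall J : {set 'I_k}, (l <= #|J|)%N ->
              #|` sumset X (Bsum B J)|%:R <= c * beta R l A B J * #|` X|%:R].
Proof.
move=> l0 _ eps0 eps1.
(* The list of admissible [J] depends only on [k] and [l], so one constant serves them all before
   the group is chosen. *)
have [J|c _ ctl] := @large_control_all R k l
  [seq J : {set 'I_k} <- enum {: {set 'I_k}} | (l <= #|J|)%N] _ eps eps0 eps1.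
  by rewrite mem_filter => /andP[lJ _]; apply: large_control_holds; rewrite l0.
exists c => G A B A0; have [X [XA cX bX]] := ctl G A B A0.
by exists X; split=> // J lJ; apply: bX; rewrite mem_filter lJ mem_enum.
Qed.
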